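(* Let $\Gamma$ be a monoid of class $\mathcal{C}$ with respect to a finite generator system $G$. Then the growth partition function $Z_{\Gamma,G}(t)$ is given by $$Z_{\Gamma,G}(t)=\sum_{S\in \mathrm{Conf}_0(\Gamma,G)}\varphi(S)\, t^{L(S)}.$$
   Context: Monoids. A monoid $\Gamma$ is cancellative if $aub=avb$ implies $u=v$. Let $G$ be a finite generating set. The length is $l(g)=\min\{n\ge 0\mid g=g_1\cdots g_n,\ g_i\in G\}$. $\Gamma$ is homogeneous with respect to $G$ if $l(gh)=l(g)+l(h)$ for all $g,h$. Write $w|_l u$ ($w$ left-divides $u$) if $u=wx$ for some $x\in\Gamma$. Condition GCD$_l$: any $u,v\in\Gamma$ have a unique greatest common left divisor $\gcd_l(u,v)$, i.e. it left-divides $u$ and $v$, and every common left divisor of $u,v$ left-divides it. For a finite nonempty subset $X\subset\Gamma$, $\gcd_l(X)$ is the greatest common left divisor of all elements of $X$. Condition CM$_r$: for all $u,v\in\Gamma$ there are $a,b\in\Gamma$ with $au=bv$. $(\Gamma,G)$ is of class $\mathcal{C}$ if $\Gamma$ is an infinite cancellative monoid, homogeneous with respect to the finite generating set $G$, satisfying GCD$_l$ and CM$_r$. Graphs. The colored Cayley graph $(\Gamma,G)$ has vertex set $\Gamma$, with an oriented edge labelled $\alpha\in G$ from $u$ to $u\alpha$. A (full) subgraph is identified with its set of vertices; an isomorphism of subgraphs $\mathbb{S}\to\mathbb{T}$ is a bijection $\psi$ of vertices such that for all $x,y\in\mathbb{S}$, $\alpha\in G$: $x\alpha=y$ iff $\psi(x)\alpha=\psi(y)$.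 $\mathrm{Conf}(\Gamma,G)$ is the set of isomorphism classes $[\mathbb{S}]$ of finite subgraphs, a commutative monoid under disjoint union with unit $[\emptyset]$, freely generated by $\mathrm{Conf}_0(\Gamma,G)$, the set of classes of (nonempty) connected finite subgraphs. For $S,T\in \mathrm{Conf}(\Gamma,G)$, $A(S,T)$ is the number of subgraphs of a representative of $T$ that are isomorphic to $S$. The ball $\Gamma_n=\{g\in\Gamma\mid l(g)\le n\}$ is identified with its class in $\mathrm{Conf}_0(\Gamma,G)$. Configuration algebra. For a commutative ring $\mathbb{A}\supset\mathbb{Q}$, $\mathbb{A}[[\mathrm{Conf}(\Gamma,G)]]$ is the completion of the monoid ring $\mathbb{A}\cdot\mathrm{Conf}(\Gamma,G)$ for the grading $\deg(S)=\#S$ (number of vertices). For $T\in\mathrm{Conf}(\Gamma,G)$ put $\mathcal{A}(T)=\sum_{S}A(S,T)\,S$ (its constant term is $1$) and $\mathcal{M}(T)=\log\mathcal{A}(T)$. The elements $\varphi(S)$, $S\in \mathrm{Conf}_0(\Gamma,G)$, are the unique elements with $\mathcal{M}(T)=\sum_{S\in \mathrm{Conf}_0(\Gamma,G)}\varphi(S)\,A(S,T)$ for all $T\in \mathrm{Conf}_0(\Gamma,G)$ (a unitriangular system); $\varphi(S)$ has only terms of degree $\ge\deg S$, and every element of the Lie-like (primitive) space $\mathcal{L}_{\mathbb{A}}(\Gamma,G)$ is uniquely a (possibly infinite) sum $\sum_S\varphi(S)a_S$, $a_S\in\mathbb{A}$. For a ring $\mathbb{B}$ (e.g. $\mathbb{Z}[[t]]$),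 $\mathcal{L}_{\mathbb{B}}(\Gamma,G)=\prod_{S\in \mathrm{Conf}_0(\Gamma,G)}\varphi(S)\cdot\mathbb{B}$. Growth partition function. $P_{\Gamma,G}(t)=\sum_{n\ge0}\#\Gamma_n\,t^n\in\mathbb{Z}[[t]]$, $P_{\Gamma,G}\mathcal{M}(t)=\sum_{n\ge0}\mathcal{M}(\Gamma_n)t^n\in\mathcal{L}_{\mathbb{Z}[[t]]}(\Gamma,G)$, and $Z_{\Gamma,G}(t)=P_{\Gamma,G}\mathcal{M}(t)/P_{\Gamma,G}(t)\in\mathcal{L}_{\mathbb{Z}[[t]]}(\Gamma,G)$. The invariant $L$. When $(\Gamma,G)$ is of class $\mathcal{C}$, each $S\in\mathrm{Conf}_0(\Gamma,G)$ has a unique representative subgraph $\mathbb{S}_0$ with $[\mathbb{S}_0]=S$ and $\gcd_l(\mathbb{S}_0)=e$ (the minimal representative), and $L(S)=\max\{l(u)\mid u\in\mathbb{S}_0\}$. *)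

(* Defs.v *)
From HB Require Import structures.
From mathcomp Require Import all_boot all_order all_algebra.
From mathcomp Require Import finmap.
From mathcomp Require Import boolp classical_sets functions cardinality fsbigop.

Set Implicit Arguments.
Unset Strict Implicit.
Unset Printing Implicit Defensive.

Import Order.TTheory GRing.Theory Num.Theory.

Local Open Scope fset_scope.
Local Open Scope classical_set_scope.
Local Open Scope ring_scope.
Local Open Scope quotient_scope.

Section MonoidNotions.
Variables (Gam : monoidType) (G : {fset Gam}).

Definition is_word (g : Gam) (s : seq Gam) : Prop :=
  {subset s <= G} /\ g = (\prod_(x <- s) x)%g.

Definition generated : Prop := forall g, exists s, is_word g s.

Definition has_word (g : Gam) (n : nat) : bool :=
  `[< exists2 s, is_word g s & size s = n >].

(* The value 0 is only a default for elements that G does not generate. *)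
Definition len (g : Gam) : nat :=
  if pselect (exists n, has_word g n) is left h then ex_minn h else 0%N.

Definition ldiv (w u : Gam) : Prop := exists x, u = (w * x)%g.

Definition is_gcdl (X : set Gam) (d : Gam) : Prop :=
  (forall u, X u -> ldiv d u) /\
  (forall w, (forall u, X u -> ldiv w u) -> ldiv w d).

Record classC : Prop := ClassC {
  classC_infinite : infinite_set [set: Gam];
  classC_cancel : forall a b u v : Gam, (a * u * b = a * v * b)%g -> u = v;
  classC_gen : generated;
  classC_homog : forall g h : Gam, len (g * h)%g = (len g + len h)%N;
  classC_gcdl : forall u v : Gam, exists! d, is_gcdl [set u; v] d;
  classC_cmr : forall u v : Gam, exists a b : Gam, (a * u = b * v)%g
}.

(* [fset_set] turns a finite classical set into a finite set; balls are
   finite because G is. *)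
Definition ball (n : nat) : {fset Gam} :=
  fset_set [set g : Gam | (len g <= n)%N].

End MonoidNotions.

(* A finite (full) subgraph of the Cayley graph is its finite set of vertices. *)
Section Configurations.
Variables (Gam : monoidType) (G : {fset Gam}).

Definition sg_iso (X Y : {fset Gam}) : Prop :=
  exists2 psi : X -> Y, bijective psi &
    forall (x y : X) (a : Gam), a \in G ->
      (val x * a)%g = val y <-> (val (psi x) * a)%g = val (psi y).

Definition sg_isob (X Y : {fset Gam}) : bool := `[< sg_iso X Y >].

Lemma sg_isob_refl : reflexive sg_isob.
Proof.
by move=> X; apply/asboolP; exists id => //; exists id.
Qed.

Lemma sg_iso_sym X Y : sg_iso X Y -> sg_iso Y X.
Proof.
move=> [psi [phi psiK phiK] psiP]; exists phi; first by exists psi.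
by move=> x y a Ga; rewrite psiP // !phiK.
Qed.

Lemma sg_isob_sym : symmetric sg_isob.
Proof.
by move=> X Y; apply/asboolP/asboolP; apply: sg_iso_sym.
Qed.

Lemma sg_iso_trans Y X Z : sg_iso X Y -> sg_iso Y Z -> sg_iso X Z.
Proof.
move=> [f fbij fP] [g gbij gP]; exists (g \o f); first exact: bij_comp.
by move=> x y a Ga; rewrite fP // gP.
Qed.

Lemma sg_isob_trans : transitive sg_isob.
Proof.
move=> Y X Z /asboolP XY /asboolP YZ; apply/asboolP; exact: sg_iso_trans XY YZ.
Qed.

Definition sg_equiv : equiv_rel {fset Gam} :=
  EquivRel sg_isob sg_isob_refl sg_isob_sym sg_isob_trans.

Definition Conf : Type := {eq_quot sg_equiv}.
HB.instance Definition _ := Choice.on Conf.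

Definition cls (X : {fset Gam}) : Conf := \pi_({eq_quot sg_equiv}) X.

Definition rep (S : Conf) : {fset Gam} := repr (S : {eq_quot sg_equiv}).

Lemma repK (S : Conf) : cls (rep S) = S.
Proof. exact: reprK. Qed.

Lemma clsP (X Y : {fset Gam}) : cls X = cls Y <-> sg_iso X Y.
Proof.
split=> [/eqP|XY]; first by rewrite /cls eqmodE => /asboolP.
by apply/eqP; rewrite /cls eqmodE; apply/asboolP.
Qed.

Definition deg (S : Conf) : nat := #|` rep S|.

Definition adj (u v : Gam) : bool :=
  [exists a : G, (u * val a == v)%g || (v * val a == u)%g].

Definition sg_conn (X : {fset Gam}) : bool :=
  (X != fset0) &&
  [forall x : X, forall y : X, connect (fun u v : X => adj (val u) (val v)) x y].

Definition Conf0 : Type := {S : Conf | sg_conn (rep S)}.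
HB.instance Definition _ := Choice.on Conf0.

(* The product S.T = U of the monoid Conf. *)
Definition dunion (S T U : Conf) : Prop :=
  exists X Y : {fset Gam},
    [/\ cls X = S, cls Y = T, cls (X `|` Y)%fset = U, [disjoint X & Y]%fset &
        forall x y, x \in X -> y \in Y -> ~~ adj x y].

Definition countA (S T : Conf) : nat :=
  #|` [fset X in fpowerset (rep T) | cls X == S]|.

(* A[[Conf]] is the set of all families of coefficients indexed by Conf. *)
Definition confalg (A : Type) : Type := Conf -> A.

Definition cone : confalg rat := fun U => (U == cls fset0)%:R.

(* The index set is finite: S and T are classes of subgraphs of U. *)
Definition cmul (f g : confalg rat) : confalg rat := fun U =>
  \sum_(p \in [set p : Conf * Conf | dunion p.1 p.2 U]) f p.1 * g p.2.

Definition cpow (f : confalg rat) (k : nat) : confalg rat :=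
  iter k (cmul f) cone.

(* Since f has constant term 1, (f - 1)^k has only terms of degree at least k,
   so that the powers with k > deg U do not contribute to the coefficient
   of U. *)
Definition clog (f : confalg rat) : confalg rat := fun U =>
  \sum_(1 <= k < (deg U).+1)
     (- 1) ^+ k.-1 / k%:R * cpow (fun V => f V - cone V) k U.

Definition calA (T : Conf) : confalg rat := fun S => (countA S T)%:R.

Definition calM (T : Conf) : confalg rat := clog (calA T).

Definition phi_system (f : Conf0 -> confalg rat) : Prop :=
  forall T : Conf0, forall U : Conf,
    calM (val T) U = \sum_(S \in [set: Conf0]) f S U * (countA (val S) (val T))%:R.

Lemma countA_gt0 (S T : Conf) : countA S T != 0%N ->
  exists2 X : {fset Gam}, (X `<=` rep T)%fset & cls X = S.
Proof.
rewrite -lt0n cardfs_gt0 => /fset0Pn [X]; rewrite !inE /= fpowersetE.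
by move=> /andP[XT /eqP XS]; exists X.
Qed.

Lemma sg_iso_card (X Y : {fset Gam}) : sg_iso X Y -> #|` X| = #|` Y|.
Proof. by move=> [psi psib _]; rewrite !cardfE; apply: bij_eq_card psib. Qed.

Lemma deg_cls (X : {fset Gam}) : deg (cls X) = #|` X|.
Proof. by apply: sg_iso_card; apply/clsP; rewrite repK. Qed.

Lemma countA_refl (T : Conf) : countA T T = 1%N.
Proof.
rewrite /countA; apply/eqP/cardfs1P; exists (rep T).
apply/fsetP => X; rewrite !inE /= fpowersetE.
apply/andP/eqP => [[XT /eqP XE]|->]; last by rewrite fsubset_refl repK eqxx.
by apply/eqP; rewrite eqEfcard XT -(deg_cls X) XE /deg leqnn.
Qed.

Lemma countA_deg (S T : Conf) : countA S T != 0%N ->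
  S = T \/ (deg S < deg T)%N.
Proof.
move=> /countA_gt0 [X XT <-]; rewrite deg_cls.
have [->|XneqT] := eqVneq X (rep T); first by left; rewrite repK.
by right; apply: fproper_ltn_card; rewrite fproperEneq XneqT.
Qed.

Lemma finite_countA (T : Conf) : finite_set [set S : Conf0 | countA (val S) T != 0%N].
Proof.
pose F := [set` [fset cls X | X in fpowerset (rep T)]%fset].
apply: (@sub_finite_set _ _ ((val : Conf0 -> Conf) @^-1` F)).
  move=> S /= /countA_gt0 [X XT XS]; apply/imfsetP; exists X => //=.
  by rewrite fpowersetE.
by apply: finite_preimage => [x y _ _|]; [apply: val_inj | apply: finite_fset].
Qed.

(* Unitriangularity: the system has one and only one solution. *)
Lemma phi_exists_unique : exists! f, phi_system f.
Proof.
pose rest (f : Conf0 -> confalg rat) (T : Conf0) (U : Conf) : rat :=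
  \sum_(S \in [set: Conf0] `\ T) f S U * (countA (val S) (val T))%:R.
have splitT (f : Conf0 -> confalg rat) (T : Conf0) (U : Conf) :
    \sum_(S \in [set: Conf0]) f S U * (countA (val S) (val T))%:R
    = f T U + rest f T U.
  set D := [set S : Conf0 | countA (val S) (val T) != 0%N].
  have D0 (S : Conf0) : ~ D S -> f S U * (countA (val S) (val T))%:R = 0.
    by move=> /negP; rewrite negbK => /eqP ->; rewrite mulr0.
  rewrite -(fsbig_widen D) //; last by move=> S [_ /D0].
  rewrite (fsbigD1 T) ?countA_refl ?mulr1; last by rewrite /D /= countA_refl.
    congr (_ + _); apply: fsbig_widen; first by move=> S [].
    by move=> S [[_ ST] DS]; apply: D0 => SD; apply: DS; split.
  exact: finite_countA.
have eq_rest (f g : Conf0 -> confalg rat) (T : Conf0) :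
    (forall S, (deg (val S) < deg (val T))%N -> f S = g S) ->
    rest f T = rest g T.
  move=> fg; apply/funext => U; apply: eq_fsbigr => S; rewrite inE => -[_ /= ST].
  have [->|/countA_deg[/val_inj//|/fg->//]] := eqVneq (countA (val S) (val T)) 0%N.
  by rewrite !mulr0.
pose step (f : Conf0 -> confalg rat) : Conf0 -> confalg rat :=
  fun T U => calM (val T) U - rest f T U.
pose sol (n : nat) : Conf0 -> confalg rat := iter n step (fun _ _ => 0).
have solE n m T : (deg (val T) < n)%N -> (deg (val T) < m)%N -> sol n T = sol m T.
  elim: n m T => // n IH [//|m] T Tn Tm.
  rewrite /sol !iterS -/(sol n) -/(sol m) /step (eq_rest (sol n) (sol m)) // => S ST.
  by apply: IH; apply: leq_trans ST _.
pose f T := sol (deg (val T)).+1 T.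
have fP : phi_system f.
  move=> T U; rewrite splitT {1}/f /sol iterS -/(sol (deg (val T))) /step.
  rewrite (eq_rest f (sol (deg (val T)))) ?subrK // => S ST.
  exact: solE.
exists f; split=> // g gP.
suff H n T : (deg (val T) < n)%N -> f T = g T.
  by apply/funext => T; apply: (H _ _ (leqnn _)).
elim: n T => // n IH T Tn; apply/funext => U.
have := fP T U; rewrite (gP T U) !splitT (eq_rest f g) => [/addIr->//|S ST].
by apply: IH; apply: leq_trans ST _.
Qed.

Definition phi : Conf0 -> confalg rat := sval (cid phi_exists_unique).

Lemma phiP : phi_system phi.
Proof. by rewrite /phi; case: cid => f []. Qed.

Lemma phi_uniq f : phi_system f -> f = phi.
Proof. by rewrite /phi; case: cid => g /= [_ gU] /gU. Qed.

Definition is_minrep (S : Conf) (X : {fset Gam}) : Prop :=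
  cls X = S /\ is_gcdl [set` X] 1%g.

(* In class C a connected S has exactly one minimal representative. *)
Definition minrep (S : Conf) : {fset Gam} := xget fset0 [set X | is_minrep S X].

Definition Linv (S : Conf) : nat := (\max_(u <- minrep S) len G u)%N.

End Configurations.

(* Formal power series in t, as sequences of coefficients. *)
Section PowerSeries.
Variable R : comNzRingType.

Definition fps : Type := nat -> R.

Definition fpsX (k : nat) : fps := fun n => (n == k)%:R.

Definition fps_mul (a b : fps) : fps := fun n =>
  \sum_(i < n.+1) a i * b (n - i)%N.

(* The first n coefficients of the inverse of a series with constant term 1. *)
Fixpoint fps_inv_seq (a : fps) (n : nat) : seq R :=
  if n is m.+1 then
    let s := fps_inv_seq a m in
    rcons s ((m == 0%N)%:R - \sum_(i < m) a (m - i)%N * s`_i)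
  else [::].

Definition fps_inv (a : fps) : fps := fun n => (fps_inv_seq a n.+1)`_n.

Lemma size_fps_inv_seq a n : size (fps_inv_seq a n) = n.
Proof. by elim: n => //= n IH; rewrite size_rcons IH. Qed.

Lemma nth_fps_inv_seq a n i : (i < n)%N -> (fps_inv_seq a n)`_i = fps_inv a i.
Proof.
elim: n => // n IH; rewrite ltnS leq_eqVlt => /predU1P[->//|i_n] /=.
by rewrite nth_rcons size_fps_inv_seq i_n IH.
Qed.

Lemma fps_mulV a : a 0%N = 1 -> fps_mul a (fps_inv a) = fpsX 0.
Proof.
move=> a0; apply/funext => n; rewrite /fps_mul (reindex_inj rev_ord_inj) /=.
under eq_bigr => i _ do rewrite subSS subKn -1?ltnS //.
rewrite big_ord_recr /= subnn a0 mul1r {2}/fps_inv /=.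
rewrite nth_rcons size_fps_inv_seq ltnn eqxx.
rewrite (eq_bigr (fun i : 'I_n => a (n - i)%N * (fps_inv_seq a n)`_i)).
  by rewrite addrC subrK.
by move=> i _; rewrite nth_fps_inv_seq.
Qed.

End PowerSeries.

Section GrowthPartition.
Variables (Gam : monoidType) (G : {fset Gam}).

Definition growthP : fps int := fun n => #|` ball G n|%:Z.

(* Elements of Q[[t]][[Conf]], the ambient space of L_{Z[[t]]}. *)
Definition tconfalg : Type := confalg G (fps rat).

Definition growthPM : tconfalg := fun U n => calM (cls G (ball G n)) U.

Definition partitionZ : tconfalg := fun U =>
  fps_mul (fun n => (fps_inv growthP n)%:~R) (growthPM U).

(* The product of phi(S) with a scalar power series. *)
Definition phi_scale (S : Conf0 G) (a : fps rat) : tconfalg := fun U n =>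
  phi S U * a n.

(* F is the sum of the family (E i): every coefficient is a sum with finitely
   many nonzero terms. *)
Definition is_tsum (I : choiceType) (E : I -> tconfalg) (F : tconfalg) : Prop :=
  forall U n, finite_set [set i | E i U n != 0] /\
              F U n = \sum_(i \in [set: I]) E i U n.

End GrowthPartition.

Arguments growthPM {Gam} G U _.
Arguments partitionZ {Gam} G U _.

(* Main.v *)
Require Import Defs.
From mathcomp Require Import all_boot all_order all_algebra finmap.
From mathcomp Require Import boolp classical_sets functions cardinality fsbigop.

Set Implicit Arguments.
Unset Strict Implicit.
Unset Printing Implicit Defensive.

Import GRing.Theory.

(** For S connected with minimal representative M, CM_r and cancellation show
    that the subgraphs in the class S are exactly the translates u M, and u is
    recovered as gcd_l(u M). Since u M lies in the ball Gamma_n iff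
    l(u) + L(S) <= n, one gets A(S, Gamma_n) = #Gamma_(n - L(S)). Hence
    sum_n M(Gamma_n) t^n = sum_n sum_S phi(S) A(S, Gamma_n) t^n
    = (sum_S phi(S) t^L(S)) P(t), and one divides by P(t). *)

Section ClassC.
Variables (Gam : monoidType) (G : {fset Gam}).
Hypothesis hC : classC G.

(** * Cancellation, length and left divisibility *)

Lemma mulgI_class (a u v : Gam) : (a * u = a * v)%g -> u = v.
Proof. by move=> E; apply: (classC_cancel hC (a := a) (b := 1%g)); rewrite E. Qed.

Lemma mulIg_class (b u v : Gam) : (u * b = v * b)%g -> u = v.
Proof.
by move=> E; apply: (classC_cancel hC (a := 1%g) (b := b)); rewrite -!mulgA E.
Qed.

Lemma has_word_len (g : Gam) : has_word G g (len G g).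
Proof.
rewrite /len; case: pselect => [h|[]]; first by case: ex_minnP.
by have [s gs] := classC_gen hC g; exists (size s); apply/asboolP; exists s.
Qed.

Lemma len_has_word (g : Gam) n : has_word G g n -> (len G g <= n)%N.
Proof.
move=> h; rewrite /len; case: pselect => [h'|[]]; last by exists n.
by case: ex_minnP => m _; apply.
Qed.

Lemma len_eq0 (g : Gam) : len G g = 0%N -> g = 1%g.
Proof.
move=> g0; have := has_word_len g; rewrite g0 => /asboolP[s [_ ->]].
by move=> /size0nil->; rewrite big_nil.
Qed.

Lemma len1 : len G 1%g = 0%N.
Proof.
have /eqP := classC_homog hC 1%g 1%g.
by rewrite mulg1 -{1}[len _ _]addn0 eqn_add2l => /eqP.
Qed.

Lemma ldiv_trans (v u w : Gam) : ldiv u v -> ldiv v w -> ldiv u w.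
Proof. by move=> [x ->] [y ->]; exists (x * y)%g; rewrite mulgA. Qed.

(** Homogeneity excludes nontrivial units: [x * y = 1] forces [x] to have length 0. This is what
    makes greatest common left divisors unique. *)
Lemma ldiv_anti (u v : Gam) : ldiv u v -> ldiv v u -> u = v.
Proof.
move=> [x vE] [y uE]; have: (x * y = 1)%g.
  by apply: (@mulgI_class u); rewrite mulgA -vE -uE mulg1.
move=> /(congr1 (len G)); rewrite (classC_homog hC) len1 => /eqP.
by rewrite addn_eq0 => /andP[/eqP/len_eq0 x1 _]; rewrite vE x1 mulg1.
Qed.

(** * Greatest common left divisors of finite sets *)

Lemma is_gcdl_uniq (X : set Gam) d d' : is_gcdl X d -> is_gcdl X d' -> d = d'.
Proof. by move=> [dX dm] [d'X d'm]; apply: ldiv_anti; auto. Qed.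

Lemma is_gcdl_exists (X : {fset Gam}) : X != fset0 ->
  exists d, is_gcdl [set` X]%classic d.
Proof.
suff H x (s : seq Gam) : exists d, is_gcdl [set u | u \in x :: s]%classic d.
  case XE: (enum_fset X) => [|x s]; last first.
    move=> _; have [d dP] := H x s; exists d.
    by rewrite (_ : [set` X]%classic = [set u | u \in x :: s]%classic) // -XE.
  by rewrite -cardfs_gt0 XE.
elim: s x => [|y s IH] x.
  exists x; split=> [u|w]; last by apply; rewrite /= !inE eqxx.
  by rewrite /= !inE => /eqP->; exists 1%g; rewrite mulg1.
(* The gcd of a longer list is the gcd of its head with the gcd of its tail. *)
have [d [dX dm]] := IH y; have [e [[eP em] _]] := classC_gcdl hC x d.
exists e; split=> [u|w wX].
  rewrite /= inE => /predU1P[->|uX]; first by apply: eP; left.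
  by apply: (@ldiv_trans d); [apply: eP; right | apply: dX].
apply: em => u [->|->]; first by apply: wX; rewrite /= !inE eqxx.
by apply: dm => v vX; apply: wX; rewrite /= inE (vX : v \in y :: s) orbT.
Qed.

(** * Left translates of subgraphs and their gcd *)

Definition translate (a : Gam) (X : {fset Gam}) : {fset Gam} :=
  [fset (a * x)%g | x in X]%fset.

Lemma translateP a X y :
  reflect (exists2 x, x \in X & y = (a * x)%g) (y \in translate a X).
Proof. exact: imfsetP. Qed.

Lemma mem_translate a X x : ((a * x)%g \in translate a X) = (x \in X).
Proof.
by apply/translateP/idP => [[y yX /mulgI_class->]//|xX]; exists x.
Qed.

Lemma translateM a b X : translate (a * b)%g X = translate a (translate b X).
Proof.
apply/fsetP => y; apply/translateP/translateP.
  by move=> [x xX ->]; exists (b * x)%g; rewrite ?mem_translate ?mulgA.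
by move=> [_ /translateP[x xX ->] ->]; exists x; rewrite ?mulgA.
Qed.

Lemma translate1 X : translate 1%g X = X.
Proof.
apply/fsetP => y; apply/translateP/idP => [[x xX ->]|yX]; first by rewrite mul1g.
by exists y; rewrite ?mul1g.
Qed.

Lemma translate_inj a : injective (translate a).
Proof.
by move=> X Y E; apply/fsetP => x; rewrite -(mem_translate a) E mem_translate.
Qed.

Lemma translate_sub a X Y :
  (translate a X `<=` translate a Y)%fset = (X `<=` Y)%fset.
Proof.
apply/fsubsetP/fsubsetP => XY x.
  by rewrite -(mem_translate a) => /XY; rewrite mem_translate.
by move=> /translateP[y yX ->]; rewrite mem_translate XY.
Qed.

Lemma translate_eq0 a X : (translate a X == fset0) = (X == fset0).
Proof.
have [->|/fset0Pn[x xX]] := eqVneq X fset0.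
  by apply/eqP/fsetP => y; apply/translateP; case.
by apply/negbTE/fset0Pn; exists (a * x)%g; rewrite mem_translate.
Qed.

Lemma sg_iso_translate a X : sg_iso G X (translate a X).
Proof.
have fP (x : X) : (a * val x)%g \in translate a X by rewrite mem_translate (valP x).
pose f (x : X) : translate a X := [` fP x ]%fset.
have finj : injective f.
  by move=> x y /(congr1 val) /mulgI_class /val_inj.
have fsurj (y : translate a X) : exists x, f x == y.
  have /translateP[x xX yE] := valP y.
  by exists [` xX ]%fset; apply/eqP/val_inj; rewrite /= yE.
exists f; last first.
  move=> x y b _; rewrite /= -mulgA; split=> [->//|]; exact: mulgI_class.
exists (fun y => xchoose (fsurj y)) => [x|y]; last exact/eqP/(xchooseP (fsurj y)).
exact/finj/eqP/(xchooseP (fsurj (f x))).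
Qed.

(** The translate has some gcd [g], and [a] divides it, say [g = a * e]. Cancelling [a] shows that
    [e] divides every element of [X], hence divides [d], so [g] divides [a * d]. *)
Lemma is_gcdl_translate a X d : X != fset0 ->
  is_gcdl [set` X]%classic d -> is_gcdl [set` translate a X]%classic (a * d)%g.
Proof.
move=> X0 [dX dm]; split=> [_ /translateP[x xX ->]|w wX].
  by have [y ->] := dX x xX; exists y; rewrite mulgA.
have [|g [gX gm]] := @is_gcdl_exists (translate a X); first by rewrite translate_eq0.
apply: ldiv_trans (gm w wX) _.
have [|e gE] := gm a; first by move=> _ /translateP[x _ ->]; exists x.
have [|f ->] := dm e; last by exists f; rewrite gE mulgA.
move=> x xX; have [|y] := gX (a * x)%g; first by rewrite /= mem_translate.
by rewrite gE -mulgA => /mulgI_class ->; exists y.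
Qed.

(** Factor out the gcd [d] of [X]. If [e] is the gcd of the quotient set, then [d * e] is again a
    gcd of [X], so [e = 1]. *)
Lemma translate_gcdl1 X : X != fset0 -> exists d Y,
  X = translate d Y /\ is_gcdl [set` Y]%classic 1%g.
Proof.
move=> X0; have [d dX] := is_gcdl_exists X0.
pose q x := xget 1%g [set y | x = (d * y)%g]%classic.
pose Y := [fset q x | x in X]%fset.
have XE : X = translate d Y.
  have qK x : x \in X -> x = (d * q x)%g.
    by move=> /(proj1 dX) [y xy]; rewrite /q; case: xgetP => // /(_ y).
  apply/fsetP => x; apply/idP/translateP => [xX|[y]].
    by exists (q x); [apply/imfsetP; exists x | apply: qK].
  by move=> /imfsetP[/= z zX ->] ->; rewrite -qK.
have Y0 : Y != fset0 by rewrite -(translate_eq0 d) -XE.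
exists d, Y; split=> //; have [e eY] := is_gcdl_exists Y0.
suff <- : e = 1%g by [].
apply: (@mulgI_class d); rewrite mulg1; apply: is_gcdl_uniq dX.
by rewrite [X in [set` X]%classic]XE; apply: is_gcdl_translate.
Qed.

(** The translating element is recovered as the gcd of the translate. *)
Lemma translate_gcdl1_inj a b X Y : X != fset0 -> Y != fset0 ->
  is_gcdl [set` X]%classic 1%g -> is_gcdl [set` Y]%classic 1%g ->
  translate a X = translate b Y -> a = b /\ X = Y.
Proof.
move=> X0 Y0 X1 Y1 E; suff ab : a = b.
  by split=> //; move: E; rewrite ab => /translate_inj.
apply: (@is_gcdl_uniq [set` translate a X]%classic).
  by rewrite -{2}[a]mulg1; apply: is_gcdl_translate.
by rewrite E -{2}[b]mulg1; apply: is_gcdl_translate.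
Qed.

(* CM_r aligns one pair of corresponding vertices; cancellation propagates the
   alignment along edges, in either direction. *)
Lemma sg_iso_common_translate X Y : sg_conn G X -> sg_iso G X Y ->
  exists a b, translate a X = translate b Y.
Proof.
move=> /andP[/fset0Pn[x0 x0X] Xc] [psi [phi psiK phiK] psiP].
pose z : X := [` x0X ]%fset.
have [a [b abE]] := classC_cmr hC (val z) (val (psi z)).
have abP (x : X) : (a * val x = b * val (psi x))%g.
  have /forallP/(_ z)/forallP/(_ x)/connectP[p zp ->] := Xc.
  elim: p (z) abE zp => //= y p IH w wE /andP[/existsP[c cE] yp]; apply: IH yp.
  case/orP: cE => /eqP cE.
    have /psiP := cE => /(_ (valP c)) cE'.
    by rewrite -cE -cE' !mulgA wE.
  have /psiP := cE => /(_ (valP c)) cE'.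
  by apply: (@mulIg_class (val c)); rewrite -!mulgA cE cE'.
exists a, b; apply/fsetP => u; apply/translateP/translateP => -[x xX ->].
  by exists (val (psi [` xX ]%fset)); rewrite ?(valP (psi _)) // -abP.
exists (val (phi [` xX ]%fset)); first exact: valP (phi _).
by rewrite abP phiK.
Qed.

(** * Minimal representatives of connected classes *)

Lemma Conf0_neq0 (S : Conf0 G) : rep (val S) != fset0.
Proof. by case/andP: (valP S). Qed.

Lemma cls_neq0 (S : Conf0 G) X : cls G X = val S -> X != fset0.
Proof.
move=> XS; rewrite -cardfs_gt0 -(deg_cls G) XS cardfs_gt0; exact: Conf0_neq0.
Qed.

(** Dividing the chosen representative by its gcd gives a witness, so the default value in [minrep]
    is never taken. *)
Lemma minrepP (S : Conf0 G) : is_minrep (val S) (minrep (val S)).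
Proof.
have [d [M [RE M1]]] := translate_gcdl1 (Conf0_neq0 S).
have SM : is_minrep (val S) M.
  split=> //; rewrite -[RHS]repK; apply/clsP; rewrite RE.
  exact: sg_iso_translate.
by rewrite /minrep; case: xgetP => // /(_ M).
Qed.

Lemma minrep_neq0 (S : Conf0 G) : minrep (val S) != fset0.
Proof. by apply: (@cls_neq0 S); case: (minrepP S). Qed.

Lemma cls_translate a X : cls G (translate a X) = cls G X.
Proof. by apply/clsP/sg_iso_sym/sg_iso_translate. Qed.

Lemma cls_minrep (S : Conf0 G) X :
  cls G X = val S -> exists c, X = translate c (minrep (val S)).
Proof.
move=> XS; have X0 := cls_neq0 XS.
have [clsM M1] := minrepP S; set M := minrep _ in clsM M1 *.
have [c [Y [XE Y1]]] := translate_gcdl1 X0; exists c.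
have Y0 : Y != fset0 by rewrite -(translate_eq0 c) -XE.
have [d [N [RE N1]]] := translate_gcdl1 (Conf0_neq0 S).
have N0 : N != fset0 by rewrite -(translate_eq0 d) -RE Conf0_neq0.
(* Uniqueness of the minimal representative: [Z] and [rep (val S)], itself a translate of [N], have
   a common translate, and both [N] and [Z] have gcd 1. *)
have uniqN Z : cls G Z = val S -> is_gcdl [set` Z]%classic 1%g -> N = Z.
  move=> ZS Z1; have Z0 := cls_neq0 ZS.
  have [||a [b E]] := @sg_iso_common_translate (rep (val S)) Z.
  - exact: (valP S).
  - by apply/clsP; rewrite repK.
  by move: E; rewrite RE -translateM => /(translate_gcdl1_inj N0 Z0 N1 Z1)[].
rewrite XE -(uniqN M) // -(uniqN Y) //.
by rewrite -XS XE cls_translate.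
Qed.

(** * Balls and the number of copies of a graph in them *)

Lemma finite_ball n : finite_set [set g : Gam | (len G g <= n)%N]%classic.
Proof.
elim: n => [|n IH].
  apply: (@sub_finite_set _ _ [set 1%g]%classic); last exact: finite_set1.
  by move=> g /=; rewrite leqn0 => /eqP/len_eq0.
apply: (@sub_finite_set _ _ ([set 1%g] `|` [set (a * g)%g | a in [set` G] &
    g in [set g | (len G g <= n)%N]])%classic); last first.
  rewrite finite_setU; split; first exact: finite_set1.
  by apply: finite_image2 => //; apply: finite_fset.
(* Split off the first letter of a shortest word for [g]; the remaining word bounds the length of
   the other factor by [n]. *)
move=> g /= gn; have /asboolP[[|a s] [sG gE] sz] := has_word_len g.
  by left; rewrite gE big_nil.
right; exists a; first by apply: sG; rewrite inE eqxx.
exists (\prod_(x <- s) x)%g; last by rewrite gE big_cons.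
apply: (@leq_trans (size s)); last by rewrite -ltnS [X in (X <= _)%N]sz.
apply/len_has_word/asboolP; exists s => //; split=> // x xs.
by apply: sG; rewrite inE xs orbT.
Qed.

Lemma mem_ball n g : (g \in ball G n) = (len G g <= n)%N.
Proof.
rewrite /ball in_fset_set; last exact: finite_ball.
by apply/idP/idP; rewrite inE.
Qed.

Lemma ball1 n : 1%g \in ball G n.
Proof. by rewrite mem_ball len1. Qed.

Lemma ball0 : ball G 0 = [fset 1%g]%fset.
Proof.
apply/fsetP => g; rewrite mem_ball inE leqn0; apply/eqP/eqP => [/len_eq0//|->].
exact: len1.
Qed.

Lemma ball_conn n : sg_conn G (ball G n).
Proof.
apply/andP; split; first by apply/fset0Pn; exists 1%g; exact: ball1.
pose e (u v : ball G n) := adj G (val u) (val v).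
have esym : symmetric e.
  by move=> u v; apply: eq_existsb => a; rewrite orbC.
pose o : ball G n := [` ball1 n ]%fset.
(* Adjacency is symmetric, so paths from the identity suffice. They follow the prefixes of a word,
   which stay in the ball by homogeneity. *)
suff H (x : ball G n) : connect e o x.
  apply/forallP => x; apply/forallP => y.
  apply: (connect_trans (y := o)); last exact: H.
  by rewrite (sym_connect_sym esym x o); apply: H.
have := valP x; case: (classC_gen hC (val x)) => s [sG xE].
elim/last_ind: s x sG xE => [|s a IH] x sG xE xn.
  by rewrite (_ : x = o) //; apply: val_inj; rewrite /= xE big_nil.
have yx : val x = ((\prod_(y <- s) y) * a)%g.
  by rewrite xE -cats1 big_cat big_seq1.
have yn : (\prod_(y <- s) y)%g \in ball G n.
  move: xn; rewrite !mem_ball yx (classC_homog hC); apply: leq_trans.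
  exact: leq_addr.
have aG : a \in G by apply: sG; rewrite mem_rcons inE eqxx.
apply: connect_trans (connect1 (_ : e [` yn ]%fset x)).
  by apply: IH => // y ys; apply: sG; rewrite mem_rcons inE ys orbT.
by apply/existsP; exists [` aG ]%fset; rewrite /= yx eqxx.
Qed.

Lemma is_gcdl_ball n : is_gcdl [set` ball G n]%classic 1%g.
Proof.
split=> [u _|w]; first by exists u; rewrite mul1g.
by apply; apply: ball1.
Qed.

Lemma ball_neq0 n : ball G n != fset0.
Proof. by apply/fset0Pn; exists 1%g; exact: ball1. Qed.

Lemma sg_iso_conn X Y : sg_iso G X Y -> sg_conn G X -> sg_conn G Y.
Proof.
move=> XY /andP[X0 Xc]; apply/andP; split.
  by rewrite -cardfs_gt0 -(sg_iso_card XY) cardfs_gt0.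
have [psi [phi psiK phiK] psiP] := XY.
apply/forallP => u; apply/forallP => v.
rewrite -[u]phiK -[v]phiK.
have /forallP/(_ (phi u))/forallP/(_ (phi v))/connectP[p] := Xc.
elim: p (phi u) => [|y p IH] x /=; first by move=> _ ->; apply: connect0.
move=> /andP[/existsP[a aP] yp] vE; apply: connect_trans (IH y yp vE).
apply/connect1/existsP; exists a; have aG := valP a.
by case/orP: aP => /eqP /(psiP _ _ _ aG) ->; rewrite eqxx ?orbT.
Qed.

Lemma rep_ball_conn n : sg_conn G (rep (cls G (ball G n))).
Proof. by apply: sg_iso_conn (ball_conn n); apply/clsP; rewrite repK. Qed.

Definition ballC n : Conf0 G := Sub (cls G (ball G n)) (rep_ball_conn n).

(** The ball contains 1, so its gcd is 1 and it is the minimal representative of its own class. *)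
Lemma rep_ball n : exists c, rep (cls G (ball G n)) = translate c (ball G n).
Proof.
have [|c RE] := @cls_minrep (ballC n) (rep (cls G (ball G n))); first exact: repK.
have [|d BE] := @cls_minrep (ballC n) (ball G n); first by [].
exists c; rewrite RE; congr translate.
have [_ M1] := minrepP (ballC n).
have := @translate_gcdl1_inj 1%g d (ball G n) (minrep (val (ballC n)))
  (ball_neq0 n) (minrep_neq0 (ballC n)) (is_gcdl_ball n) M1.
by rewrite translate1 => /(_ BE)[].
Qed.

Lemma translate_minrep_sub_ball (S : Conf0 G) v n :
  (translate v (minrep (val S)) `<=` ball G n)%fset =
  (len G v + Linv (val S) <= n)%N.
Proof.
have /fset0Pn[x0 x0M] := minrep_neq0 S.
apply/fsubsetP/idP => [sub|le _ /translateP[x xM ->]]; last first.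
  rewrite mem_ball (classC_homog hC); apply: leq_trans le.
  by rewrite leq_add2l /Linv; apply: leq_bigmax_seq.
have le x : x \in minrep (val S) -> (len G v + len G x <= n)%N.
  by move=> xM; rewrite -(classC_homog hC) -mem_ball sub // mem_translate.
(* This bound, which needs a vertex of the minimal representative, makes [n - len G v] a genuine
   difference. *)
have vn : (len G v <= n)%N by apply: leq_trans (le _ x0M); apply: leq_addr.
rewrite -leq_subRL // /Linv; apply/bigmax_leqP_seq => x xM _.
by rewrite leq_subRL // le.
Qed.

(* [countA] counts inside the chosen representative of the class of the ball,
   which is only a translate of the ball ([rep_ball]). *)
Lemma countA_ball (S : Conf0 G) n : countA (val S) (cls G (ball G n)) =
  if (Linv (val S) <= n)%N then #|` ball G (n - Linv (val S))| else 0%N.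
Proof.
have [c RE] := rep_ball n; have [MS M1] := minrepP S.
have M0 := minrep_neq0 S.
rewrite /countA RE; set M := minrep _ in MS M1 M0 *.
have subP v : (translate (c * v)%g M `<=` translate c (ball G n))%fset
    = (len G v + Linv (val S) <= n)%N.
  by rewrite translateM translate_sub translate_minrep_sub_ball.
have fibre X : (X `<=` translate c (ball G n))%fset -> cls G X = val S ->
    exists2 v, (len G v + Linv (val S) <= n)%N & X = translate (c * v)%g M.
  move=> Xc XS; have [u XE] := cls_minrep XS.
  have [_ um] : is_gcdl [set` X]%classic u.
    by rewrite XE -{2}[u]mulg1; apply: is_gcdl_translate.
  (* Every vertex of [X] is divisible by [c], hence so is the gcd [u] of [X]. *)
  have [|v uE] := um c.
    by move=> x /(fsubsetP Xc)/translateP[y _ ->]; exists y.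
  have XE' : X = translate (c * v)%g M by rewrite -uE.
  by exists v => //; rewrite -subP -XE'.
case: leqP => [Ln|nL]; last first.
  apply/eqP; rewrite cardfs_eq0; apply/eqP/fsetP => X; rewrite !inE /= fpowersetE.
  apply/negP => /andP[Xc /eqP /(fibre _ Xc)[v vL _]].
  by move: nL; rewrite ltnNge (leq_trans _ vL) ?leq_addl.
transitivity #|` [fset translate (c * v)%g M | v in ball G (n - Linv (val S))]%fset|.
  congr (size (enum_fset _)); apply/fsetP => X; apply/idP/imfsetP => /= [|[v vB ->]].
    rewrite !inE /= fpowersetE => /andP[Xc /eqP /(fibre _ Xc)[v vL ->]].
    by exists v; rewrite // mem_ball leq_subRL // addnC.
  rewrite !inE /= fpowersetE subP cls_translate MS eqxx.
  by move: vB; rewrite mem_ball leq_subRL // addnC => ->.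
by apply: card_in_imfset => v w _ _ /(translate_gcdl1_inj M0 M0 M1 M1)[/mulgI_class].
Qed.

(** Such a class is determined by its minimal representative, which is one of the finitely many
    subsets of the ball of radius [n]. *)
Lemma finite_Linv n : finite_set [set S : Conf0 G | (Linv (val S) <= n)%N]%classic.
Proof.
pose F := [set` [fset cls G X | X in fpowerset (ball G n)]%fset]%classic.
apply: (@sub_finite_set _ _ ((val : Conf0 G -> Conf G) @^-1` F)%classic).
  move=> S /= LS; apply/imfsetP; exists (minrep (val S)) => /=.
    by rewrite fpowersetE -[minrep _]translate1 translate_minrep_sub_ball len1.
  by have [] := minrepP S.
by apply: finite_preimage => [x y _ _|]; [apply: val_inj | apply: finite_fset].
Qed.

End ClassC.

(** * Division by the growth series *)

Lemma fps_mulC (R : comNzRingType) (a b : fps R) : fps_mul a b = fps_mul b a.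
Proof.
apply/funext => n; rewrite /fps_mul (reindex_inj rev_ord_inj) /=.
by apply: eq_bigr => i _; rewrite subSS subKn -1?ltnS // mulrC.
Qed.

Theorem mainTheorem1 (Gam : monoidType) (G : {fset Gam}) (hC : classC G) :
  is_tsum
    (fun S : Conf0 G => phi_scale S (fpsX rat (Linv (val S))))
    (partitionZ G).
Proof.
Local Open Scope ring_scope.
Local Open Scope classical_set_scope.
move=> U n; pose D := [set S : Conf0 G | (Linv (val S) <= n)%N].
have Dfin : finite_set D := finite_Linv hC n.
split.
  apply: sub_finite_set Dfin => S; rewrite /D /= /phi_scale /fpsX.
  by have [->//|_] := eqVneq n (Linv (val S)); rewrite mulr0 eqxx.
have P0 : growthP G 0%N = 1 by rewrite /growthP (ball0 hC) cardfs1.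
(* A class with L(S) > m has no copy in the ball of radius [m]. All coefficients up to order [n] are
   thus sums over the same finite set [D], so the two summations can be exchanged. *)
have coefM m : (m <= n)%N -> growthPM G U m =
    \sum_(S \in D) phi S U * (countA (val S) (cls G (ball G m)))%:R.
  (* The defining system of [phi] applies because the ball is connected. *)
  move=> mn; rewrite /growthPM -[cls _ _]/(val (ballC hC m)) phiP.
  symmetry; apply: fsbig_widen => // S [_ /= nD].
  rewrite (countA_ball hC) leqNgt (leq_ltn_trans mn) ?mulr0 // ltnNge.
  exact/negP.
rewrite /partitionZ /fps_mul.
under eq_bigr => i _ do rewrite coefM ?leq_subr // fsbig_finite //= mulr_sumr.
rewrite exchange_big /= -(fsbig_widen D) //; last first.
  move=> S [_ /= nD]; rewrite /phi_scale /fpsX; have [nL|_] := eqVneq n (Linv (val S));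
    last by rewrite mulr0.
  by case: nD; rewrite /D /= -nL.
rewrite fsbig_finite //=; apply: eq_fbigr => S.
rewrite in_fset_set // inE => /= LS _.
under eq_bigr => i _ do rewrite mulrCA (countA_ball hC).
rewrite -mulr_sumr /phi_scale; congr (_ * _).
set L := Linv _ in LS *.
(* For fixed [S] the claim is the coefficient of order [n - L] in P(t)^(-1) P(t) = 1; as L <= n, the
   right side is 1 exactly when n = L. *)
have /(congr1 (fun f => f (n - L)%N)) := fps_mulV P0.
rewrite fps_mulC /fps_mul /fpsX /growthP => /(congr1 (intmul (1 : rat))).
rewrite raddf_sum /= subn_eq0 [(n <= L)%N]leq_eqVlt ltnNge LS orbF.
rewrite mulrz_nat => <-.
(* The sum over i <= n - L is extended to i <= n; the added indices are those with n - i < L, where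
   the count is 0. *)
rewrite (big_ord_widen n.+1 (fun i =>
  (fps_inv (growthP G) i * #|` ball G (n - L - i)|%:Z)%:~R)) ?ltnS ?leq_subr //.
rewrite [RHS]big_mkcond /=; apply: eq_bigr => i _.
rewrite ltnS (leq_subRL _ LS) (leq_subRL _ (leq_ord i)) addnC.
case: ifP => _; last by rewrite mulr0.
by rewrite rmorphM /= subnAC.
Qed.
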